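(* Fix $0<\alpha<1$. There exists a constant $c(\alpha)>0$, depending only on $\alpha$ (in particular independent of $\varepsilon$ and $f$), such that for every $f\in\Lambda_{\alpha}(\mathbb{R})$ the following hold, where for $0<\varepsilon<1/2$ and $x\in\mathbb{R}$ $$\Theta_{\varepsilon}(f)(x)=\int_{\varepsilon}^{1}\frac{f(x+h)-f(x-h)}{h^{\alpha}}\,\frac{dh}{h}.$$ (a) For any interval $I\subset\mathbb{R}$ of length $|I|=1$ and any $0<\varepsilon<1/2$, $$\int_{I}|\Theta_{\varepsilon}(f)(x)|^{2}\,dx\le c(\alpha)\,\log(1/\varepsilon)\,\|f\|_{\alpha}^{2}.$$ (b) At almost every point $x\in\mathbb{R}$ (with respect to Lebesgue measure), $$\limsup_{\varepsilon\to0^{+}}\frac{|\Theta_{\varepsilon}(f)(x)|}{\sqrt{\log(1/\varepsilon)\,\log\log\log(1/\varepsilon)}}\le c(\alpha)\|f\|_{\alpha}.$$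
   Context: For $0<\alpha<1$, $\Lambda_{\alpha}(\mathbb{R})$ is the class of functions $f\colon\mathbb{R}\to\mathbb{R}$ for which there exists a constant $C>0$ with $|f(x)-f(y)|\le C|x-y|^{\alpha}$ for all $x,y\in\mathbb{R}$. The infimum of such constants $C$ is denoted by $\|f\|_{\alpha}$. *)

(* Defs.v *)
From HB Require Import structures.
From mathcomp Require Import all_boot all_order all_algebra.
From mathcomp Require Import all_classical all_reals all_analysis.

Set Implicit Arguments.
Unset Strict Implicit.
Unset Printing Implicit Defensive.

Import Order.TTheory GRing.Theory Num.Theory.
Import numFieldNormedType.Exports.

Local Open Scope classical_set_scope.
Local Open Scope ring_scope.

Definition holder_constants (R : realType) (alpha : R) (f : R -> R) : set R :=
  [set C | 0 < C /\ forall x y : R, `|f x - f y| <= C * `|x - y| `^ alpha].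

Definition holder_class (R : realType) (alpha : R) : set (R -> R) :=
  [set f | holder_constants alpha f !=set0].

(* [inf] has the junk value 0 on the empty set, so this is the Hoelder
   seminorm only for f in [holder_class alpha]. *)
Definition holder_norm (R : realType) (alpha : R) (f : R -> R) : R :=
  inf (holder_constants alpha f).

(* For 0 < eps <= 1 and f continuous the integrand is continuous on [eps, 1],
   so that the real-valued integral is the honest one. *)
Definition Theta (R : realType) (alpha eps : R) (f : R -> R) (x : R) : R :=
  \int[@lebesgue_measure R]_(h in `[eps, 1])
     ((f (x + h) - f (x - h)) / h `^ alpha / h).

(* Main.v *)
Require Import Defs.
From HB Require Import structures.
From mathcomp Require Import all_boot all_order all_algebra.
From mathcomp Require Import ring lra.
From mathcomp Require Import all_classical all_reals all_analysis measurable_realfun.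

Set Implicit Arguments.
Unset Strict Implicit.
Unset Printing Implicit Defensive.

Import Order.TTheory GRing.Theory Num.Theory.
Import numFieldNormedType.Exports.

Local Open Scope classical_set_scope.
Local Open Scope ring_scope.

(** Both bounds come from one discrete martingale that shadows Theta.  Write
    S k for Theta at scale 2^-k and C for a Hoelder constant of f.

    Each octave of scales changes Theta by at most 2 C (Theta_octave), and S k
    varies by at most a constant times C on an interval of length 2^-k
    (Theta_holder).  The essential point is cancellation: on an interval of
    length L, the mean of the part of Theta coming from scales h < L is O(C),
    since the integral of f (x + h) - f (x - h) over the interval telescopes to
    the difference of two means of f over windows of width 2 h at its two
    ends, which is O(h L^alpha), and h L^(alpha - 1) is integrable against
    h^(- alpha - 1) near 0 because alpha < 1.  It is enough to use means over a
    mesh of step 2^-N, for which the telescoping is that of a finite sum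
    (difference_block_sum, Theta_block_sum).

    Fix a horizon N.  The means of S N over the mesh points of the dyadic
    subintervals of a unit interval form a dyadic martingale; by the above, its
    value on an interval of length 2^-k is within O(C) of S k there
    (block_mean_Theta), so its increments are bounded by some D = O(C)
    (block_mean_increment) and it starts at O(C) (root_block_mean).

    For the L^2 bound, orthogonality of the increments gives a mean square of
    order N D^2 (integral_sqr_block), and N is comparable to log (1 / eps).

    For the iterated logarithm, the maximal exponential inequality for
    martingales with bounded increments (exceedance_measure), applied with
    N = 2^j, shows that the largest of the first N values exceeds
    4 D sqrt (N log j) only on a set of measure O(1 / j^2).  By
    Borel-Cantelli, almost every point is in finitely many of these sets; and
    when eps is about 2^-k with 2^(j-1) <= k < 2^j, N is comparable to
    log (1 / eps) and log j to log log log (1 / eps). *)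

(** * Elementary bounds, powers and their integrals *)

(** For x < 1 the bound 1 - x <= exp (- x) inverts to
    exp x <= 1 / (1 - x), whose right-hand side is 1 + x + x^2 / (1 - x). *)
Lemma expR_le_quadratic (R : realType) (x : R) : `|x| <= 1 / 2 ->
  expR x <= 1 + x + 2 * x ^+ 2.
Proof.
rewrite ler_norml => /andP[h1 h2].
have h : expR (- x) >= 1 - x by rewrite expR_ge1Dx.
have {}h : expR x <= (1 - x)^-1.
  have -> : expR x = (expR (- x))^-1 by rewrite expRN invrK.
  by rewrite lef_pV2 ?posrE ?expR_gt0//; lra.
apply: (le_trans h); rewrite -div1r ler_pdivrMr; last by lra.
have -> : (1 + x + 2 * x ^+ 2) * (1 - x) = 1 + x ^+ 2 * (1 - 2 * x) by ring.
by rewrite lerDl mulr_ge0 ?sqr_ge0//; lra.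
Qed.

Lemma coshR_le_gauss (R : realType) (x : R) : `|x| <= 1 / 2 ->
  expR x + expR (- x) <= 2 * expR (2 * x ^+ 2).
Proof.
move=> hx; have := expR_le_quadratic hx.
have := @expR_le_quadratic R (- x); rewrite normrN => /(_ hx).
rewrite sqrrN.
have := expR_ge1Dx (2 * x ^+ 2); lra.
Qed.

(** Used both for f itself and for the function Theta alpha eps f, which
    inherits the exponent of f. *)
Lemma sub_powR_continuous (R : realType) (a K : R) (u : R -> R) :
  0 < a -> 0 <= K -> (forall x y, `|u x - u y| <= K * `|x - y| `^ a) ->
  continuous u.
Proof.
move=> a0 K0 hu x.
apply/cvgrPdist_le => /= e e0.
have K1 : 0 < K + 1 by lra.
have d0 : 0 < (e / (K + 1)) `^ a^-1 by rewrite powR_gt0// divr_gt0.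
exists ((e / (K + 1)) `^ a^-1) => //= y /= hy.
apply: (le_trans (hu x y)).
have h : `|x - y| `^ a <= e / (K + 1).
  have -> : e / (K + 1) = ((e / (K + 1)) `^ a^-1) `^ a.
    by rewrite -powRrM mulVf ?gt_eqF// powRr1// ltW// divr_gt0.
  by apply: ge0_ler_powR; rewrite ?nnegrE ?powR_ge0// ltW.
apply: (le_trans (ler_wpM2l K0 h)).
rewrite mulrA ler_pdivrMr// mulrC; apply: ler_wpM2l; lra.
Qed.

Lemma continuous_powR_base (R : realType) (b : R) (x : R) : 0 < x ->
  {for x, continuous (fun h : R => h `^ b)}.
Proof.
move=> x0; apply: differentiable_continuous; apply/derivable1_diffP.
by apply: derivable_powR; rewrite in_itv/= andbT.
Qed.

Section integrals.
Variable R : realType.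
Notation mu := (@lebesgue_measure R).

Lemma integrable_continuous_pos (u : R -> R) (a b : R) : 0 < a ->
  (forall x, 0 < x -> {for x, continuous u}) ->
  mu.-integrable `[a, b] (EFin \o u).
Proof.
move=> a0 cu; apply: continuous_compact_integrable; first exact: segment_compact.
apply: continuous_in_subspaceT => x; rewrite inE/= in_itv/= => /andP[ax _].
by apply: cu; exact: lt_le_trans ax.
Qed.

Lemma powR_Rintegral (p a b : R) : p != 0 -> 0 < a -> a <= b ->
  \int[mu]_(h in `[a, b]) h `^ (p - 1) = (b `^ p - a `^ p) / p.
Proof.
move=> p0 a0; rewrite le_eqVlt => /predU1P[<-|ab].
  by rewrite set_itv1 Rintegral_set1 subrr mul0r.
have cp (q x : R) : a <= x -> {for x, continuous (fun h : R => h `^ q)}.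
  by move=> ax; apply: continuous_powR_base; exact: lt_le_trans ax.
have cF x : a <= x -> {for x, continuous (fun h : R => p^-1 * h `^ p)}.
  by move=> ax; apply: cvgM; [exact: cvg_cst|exact: cp].
have dF (x : R) : 0 < x -> is_derive x 1 (fun h : R => p^-1 * h `^ p) (p^-1 * (p * x `^ (p - 1))).
  by move=> x0; have h := is_derive1_powR p x0; exact: is_deriveZ.
rewrite /Rintegral (@continuous_FTC2 _ _ (fun h => p^-1 * h `^ p))//=.
- by rewrite -mulrBr mulrC.
- by apply: continuous_in_subspaceT => x; rewrite inE/= in_itv/= => /andP[ax _]; exact: cp.
- split.
  + move=> x; rewrite in_itv/= => /andP[ax _].
    have x0 : 0 < x by lra.
    by have [] := dF x x0.
  + by apply: cvg_at_right_filter; apply: cF.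
  + by apply: cvg_at_left_filter; apply: cF; exact: ltW.
- move=> x; rewrite in_itv/= => /andP[ax _].
  have x0 : 0 < x by lra.
  by rewrite derive1E (@derive_val _ _ _ _ _ _ _ (dF x x0)) mulrA mulVf// mul1r.
Qed.

End integrals.

Section more_integrals.
Variable R : realType.
Notation mu := (@lebesgue_measure R).
Implicit Types (u v : R -> R) (a b c x : R).

Lemma Rintegral_norm_le u v a b : 0 < a ->
  (forall x, 0 < x -> {for x, continuous u}) ->
  (forall x, 0 < x -> {for x, continuous v}) ->
  (forall x, a <= x <= b -> `|u x| <= v x) ->
  `|\int[mu]_(x in `[a, b]) u x| <= \int[mu]_(x in `[a, b]) v x.
Proof.
move=> a0 cu cv uv.
have mab : measurable (`[a, b] : set R) by exact: measurable_itv.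
apply: le_trans.
  by apply: le_normr_Rintegral => //; exact: integrable_continuous_pos.
apply: le_Rintegral => //.
- apply: (@integrable_continuous_pos _ (fun x => `|u x|)) => // x x0.
  by apply: continuous_comp; [exact: cu|exact: norm_continuous].
- exact: integrable_continuous_pos.
Qed.

Lemma Rintegral_split u a b c : 0 < a -> a <= b -> b <= c ->
  (forall x, 0 < x -> {for x, continuous u}) ->
  \int[mu]_(x in `[a, c]) u x =
  \int[mu]_(x in `[a, b]) u x + \int[mu]_(x in `[b, c]) u x.
Proof.
move=> a0 ab bc cu.
have b0 : 0 < b := lt_le_trans a0 ab.
rewrite -(@Rintegral_itv_obnd_cbnd _ b (BRight c)); last first.
  apply: (@integrableS _ _ _ mu `[b, c]) => //.
    exact: subset_itv_oc_cc.
  exact: integrable_continuous_pos.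
rewrite -(@Rintegral_itvB _ u (BLeft a) (BRight c) b).
- by rewrite addrCA subrr addr0.
- exact: integrable_continuous_pos.
- by rewrite bnd_simp.
- by rewrite bnd_simp.
Qed.

Lemma continuous_bigsum (g : nat -> R -> R) (x : R) n :
  (forall l, {for x, continuous (g l)}) ->
  {for x, continuous (fun h => \sum_(l < n) g l h)}.
Proof.
move=> cg; elim: n => [|n ih].
  have -> : (fun h => \sum_(l < 0) g l h) = cst 0.
    by apply/funext => h; rewrite big_ord0.
  exact: cvg_cst.
have -> : (fun h => \sum_(l < n.+1) g l h) =
    (fun h => \sum_(l < n) g l h) \+ g n.
  by apply/funext => h; rewrite big_ord_recr.
by apply: cvgD; [exact: ih|exact: cg].
Qed.

Lemma Rintegral_bigsum (g : nat -> R -> R) a b n : 0 < a ->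
  (forall l x, 0 < x -> {for x, continuous (g l)}) ->
  \int[mu]_(x in `[a, b]) (\sum_(l < n) g l x) =
  \sum_(l < n) \int[mu]_(x in `[a, b]) g l x.
Proof.
move=> a0 cg; elim: n => [|n ih].
  under eq_Rintegral do rewrite big_ord0.
  by rewrite Rintegral_cst// mul0r big_ord0.
under eq_Rintegral do rewrite big_ord_recr/=.
rewrite RintegralD//.
- by rewrite ih big_ord_recr.
- apply: (@integrable_continuous_pos _ (fun h => \sum_(l < n) g l h)) => // x x0.
  by apply: continuous_bigsum => l; exact: cg.
- by apply: integrable_continuous_pos => // x x0; exact: cg.
Qed.

End more_integrals.

(** Both sides are the sum of g over [0, m + q[ minus the sums of g over
    [0, m[ and [0, q[.  When q is small against m this replaces many small
    differences by few large ones. *)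
Lemma sum_shift_telescope (V : zmodType) (g : nat -> V) (m q : nat) :
  \sum_(l < m) (g (l + q)%N - g l) = \sum_(l < q) (g (m + l)%N - g l).
Proof.
rewrite !sumrB; apply/eqP; rewrite subr_eq addrAC eq_sym subr_eq; apply/eqP.
have h (a b : nat) : \sum_(l < a) g l + \sum_(l < b) g (a + l)%N = \sum_(l < a + b) g l.
  by rewrite big_split_ord.
rewrite addrC h; under [in RHS]eq_bigr do rewrite addnC.
by rewrite addrC h addnC.
Qed.

(** * Size, regularity and cancellation of Theta *)

Lemma continuous_scale_powR (R : realType) (K b x : R) : 0 < x ->
  {for x, continuous (fun h : R => K * h `^ b)}.
Proof. by move=> x0; apply: cvgM; [exact: cvg_cst|exact: continuous_powR_base]. Qed.

(** The integrand of Theta, as a function of h. *)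
Definition divided_difference (R : realType) (alpha : R) (f : R -> R) (x h : R) : R :=
  (f (x + h) - f (x - h)) / h `^ alpha / h.

Section holder_estimates.
Variables (R : realType) (alpha C : R) (f : R -> R).
Hypotheses (alpha_gt0 : 0 < alpha) (alpha_lt1 : alpha < 1) (C_ge0 : 0 <= C).
Hypothesis hf : forall x y : R, `|f x - f y| <= C * `|x - y| `^ alpha.

Notation mu := (@lebesgue_measure R).
Notation dd := (divided_difference alpha f).

Lemma holder_le x y d : `|x - y| <= d -> `|f x - f y| <= C * d `^ alpha.
Proof.
move=> xyd; apply: (le_trans (hf x y)); apply: ler_wpM2l => //.
apply: ge0_ler_powR => //; first exact: ltW.
by rewrite nnegrE (le_trans _ xyd).
Qed.

Lemma divided_differenceE x h : 0 < h ->
  dd x h = (f (x + h) - f (x - h)) * h `^ (- alpha - 1).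
Proof.
move=> h0; rewrite /divided_difference -mulrA; congr (_ * _).
rewrite -(powR_inv1 (ltW h0)) -powRN -powRD//.
by rewrite (gt_eqF h0) implybT.
Qed.

Lemma continuous_divided_difference x h : 0 < h ->
  {for h, continuous (dd x)}.
Proof.
move=> h0; have cf := sub_powR_continuous alpha_gt0 C_ge0 hf.
apply: cvgM; first apply: cvgM.
- apply: cvgB.
  + apply: continuous_comp; last exact: cf.
    by apply: cvgD; [exact: cvg_cst|exact: cvg_id].
  + apply: continuous_comp; last exact: cf.
    by apply: cvgB; [exact: cvg_cst|exact: cvg_id].
- apply: cvgV; first by rewrite gt_eqF// powR_gt0.
  exact: continuous_powR_base.
- by apply: cvgV; [rewrite gt_eqF|exact: cvg_id].
Qed.

Lemma Theta_split a b x : 0 < a -> a <= b -> b <= 1 ->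
  Theta alpha a f x = \int[mu]_(h in `[a, b]) dd x h + Theta alpha b f x.
Proof.
by move=> a0 ab b1; apply: Rintegral_split => // h; exact: continuous_divided_difference.
Qed.

Lemma Theta1 x : Theta alpha 1 f x = 0.
Proof. by rewrite /Theta set_itv1 Rintegral_set1. Qed.

Lemma powRNB1_integral_le a b : 0 < a -> a <= b ->
  \int[mu]_(h in `[a, b]) h `^ (- alpha - 1) <= a `^ (- alpha) / alpha.
Proof.
move=> a0 ab; rewrite powR_Rintegral ?oppr_eq0 ?gt_eqF//.
rewrite invrN mulrN -mulNr opprB ler_pM2r ?invr_gt0//.
by rewrite gerBl powR_ge0.
Qed.

Lemma powRN_integral_le a b : 0 < a -> a <= b ->
  \int[mu]_(h in `[a, b]) h `^ (- alpha) <= b `^ (1 - alpha) / (1 - alpha).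
Proof.
move=> a0 ab.
have a1 : 0 < 1 - alpha by rewrite subr_gt0.
have := @powR_Rintegral R (1 - alpha) a b.
rewrite (_ : 1 - alpha - 1 = - alpha); last by ring.
move=> ->//; last by rewrite gt_eqF.
by rewrite ler_pM2r ?invr_gt0// gerBl powR_ge0.
Qed.

(** The increments f (x + h) - f (y + h) and f (x - h) - f (y - h) are at most
    C |x - y|^alpha, and the weight h^(- alpha - 1) integrates over [eps, 1] to
    at most eps^(- alpha) / alpha.  Hence Theta is essentially constant
    at scale eps. *)
Lemma Theta_holder eps x y : 0 < eps -> eps <= 1 ->
  `|Theta alpha eps f x - Theta alpha eps f y| <=
  2 * C / alpha * (`|x - y| `^ alpha * eps `^ (- alpha)).
Proof.
move=> e0 e1.
rewrite /Theta -RintegralB//; last 2 first.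
- by apply: (@integrable_continuous_pos _ (dd x)) => // h; exact: continuous_divided_difference.
- by apply: (@integrable_continuous_pos _ (dd y)) => // h; exact: continuous_divided_difference.
set K := 2 * C * `|x - y| `^ alpha.
have K0 : 0 <= K by rewrite !mulr_ge0 ?powR_ge0.
apply: (@le_trans _ _ (\int[mu]_(h in `[eps, 1]) (K * h `^ (- alpha - 1)))).
  apply: (@Rintegral_norm_le _ (fun h => dd x h - dd y h)) => //.
  - by move=> h h0; apply: cvgB; exact: continuous_divided_difference.
  - by move=> h; exact: continuous_scale_powR.
  move=> h /andP[eh _]; have h0 : 0 < h by exact: lt_le_trans eh.
  rewrite !divided_differenceE// -mulrBl normrM (ger0_norm (powR_ge0 _ _)).
  apply: ler_wpM2r; first exact: powR_ge0.
  have -> : f (x + h) - f (x - h) - (f (y + h) - f (y - h)) =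
    (f (x + h) - f (y + h)) - (f (x - h) - f (y - h)) by ring.
  apply: (le_trans (ler_normB _ _)).
  have hp := hf (x + h) (y + h); have hm := hf (x - h) (y - h).
  apply: (le_trans (lerD hp hm)).
  have -> : x - h - (y - h) = x - y by ring.
  have -> : x + h - (y + h) = x - y by ring.
  by rewrite /K le_eqVlt; apply/orP; left; apply/eqP; ring.
rewrite RintegralZl//; last by apply: integrable_continuous_pos => // h; exact: continuous_powR_base.
apply: (le_trans (ler_wpM2l K0 (powRNB1_integral_le e0 e1))).
by rewrite /K le_eqVlt; apply/orP; left; apply/eqP; ring.
Qed.

(** Over one octave of scales the integrand is at most 2 C / a on a set of
    length at most a: every single scale contributes a bounded amount. *)
Lemma Theta_octave a b x : 0 < a -> a <= b -> b <= 2 * a -> b <= 1 ->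
  `|Theta alpha a f x - Theta alpha b f x| <= 2 * C.
Proof.
move=> a0 ab b2a b1; rewrite (Theta_split x a0 ab b1) addrK.
apply: (@le_trans _ _ (\int[mu]_(h in `[a, b]) (2 * C / a))).
  apply: (@Rintegral_norm_le _ _ (fun=> 2 * C / a)) => //.
  - by move=> h; exact: continuous_divided_difference.
  - by move=> h h0; exact: cvg_cst.
  move=> h /andP[ah _]; have h0 : 0 < h by exact: lt_le_trans ah.
  rewrite /divided_difference !normrM !normfV (ger0_norm (powR_ge0 _ _)) (gtr0_norm h0).
  apply: ler_pM.
  - by rewrite divr_ge0// powR_ge0.
  - by rewrite invr_ge0 ltW.
  - rewrite ler_pdivrMr ?powR_gt0//.
    apply: (le_trans (hf _ _)).
    have -> : x + h - (x - h) = 2 * h by ring.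
    rewrite gtr0_norm ?mulr_gt0// powRM// ?(ltW h0)//.
    rewrite mulrA; apply: ler_wpM2r; first exact: powR_ge0.
    rewrite mulrC; apply: ler_wpM2r => //.
    rewrite -[leRHS]powRr1//; apply: ler_powR; [lra|exact: ltW].
  - by rewrite lef_pV2.
rewrite Rintegral_cst; last exact: measurable_itv.
rewrite /= lebesgue_measure_itv/= lte_fin.
case: ltP => _ /=; last by rewrite mulr0 mulr_ge0.
rewrite mulrAC ler_pdivrMr//; apply: ler_wpM2l; first by rewrite mulr_ge0.
by rewrite lerBlDr -mulr2n -mulr_natl.
Qed.

(** This is where symmetric differences cancel.  If 2 h is a multiple
    q delta of the mesh, then the sum over the mesh telescopes down to q
    differences at distance m delta, which gives the gain
    (h / (m delta))^(1 - alpha) over the trivial bound.  In general 2 h is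
    rounded down to a multiple of delta, at a cost of C delta^alpha per term. *)
Lemma difference_block_sum (y h delta : R) (m : nat) : 0 < delta -> 0 < h ->
  (0 < m)%N ->
  `|\sum_(l < m) (f (y + l%:R * delta + h) - f (y + l%:R * delta - h))| <=
  m%:R * C * (delta `^ alpha + 2 * h * (m%:R * delta) `^ (alpha - 1)).
Proof.
move=> d0 h0 m0.
(* q is the number of mesh steps in 2 h *)
pose q := Num.truncn (2 * h / delta).
have q_itv : q%:R <= 2 * h / delta < q.+1%:R.
  by rewrite Num.Theory.truncn_itv// divr_ge0 ?mulr_ge0 ?ltW.
case/andP: q_itv => q1 q2.
have q1' : q%:R * delta <= 2 * h by rewrite -ler_pdivlMr.
have q2' : 2 * h < q%:R * delta + delta.
  by move: q2; rewrite ltr_pdivrMr// -(natr1 q) (mulrDl q%:R) mul1r.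
pose g (l : nat) := f (y - h + l%:R * delta).
have mR0 : 0 < m%:R :> R by rewrite ltr0n.
set L := m%:R * delta.
have L0 : 0 < L by rewrite mulr_gt0.
have -> : \sum_(l < m) (f (y + l%:R * delta + h) - f (y + l%:R * delta - h)) =
  \sum_(l < m) (f (y + l%:R * delta + h) - g (l + q)%N) +
  \sum_(l < m) (g (l + q)%N - g l).
  rewrite -big_split/=; apply: eq_bigr => l _.
  rewrite addrA subrK; congr (_ - f _); ring.
rewrite sum_shift_telescope.
apply: (le_trans (ler_normD _ _)).
rewrite mulrDr; apply: lerD.
  apply: (le_trans (ler_norm_sum _ _ _)).
  have -> : m%:R * C * delta `^ alpha = \sum_(l < m) (C * delta `^ alpha).
    by rewrite sumr_const card_ord -mulrA mulr_natl.
  apply: ler_sum => l _; apply: holder_le; rewrite natrD.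
  have -> : y + l%:R * delta + h - (y - h + (l%:R + q%:R) * delta) =
    2 * h - q%:R * delta by ring.
  rewrite ler_norml; apply/andP; split; lra.
apply: (le_trans (ler_norm_sum _ _ _)).
apply: (@le_trans _ _ (\sum_(l < q) (C * L `^ alpha))).
  apply: ler_sum => l _; apply: holder_le; rewrite natrD.
  have -> : y - h + (m%:R + l%:R) * delta - (y - h + l%:R * delta) = L.
    rewrite /L; ring.
  by rewrite gtr0_norm.
rewrite sumr_const card_ord -[leLHS]mulr_natl.
have -> : L `^ alpha = L * L `^ (alpha - 1) by rewrite mulr_powRB1// ltW.
have -> : q%:R * (C * (L * L `^ (alpha - 1))) =
  (q%:R * delta) * (m%:R * C * L `^ (alpha - 1)) by rewrite /L; ring.
have -> : m%:R * C * (2 * h * L `^ (alpha - 1)) =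
  (2 * h) * (m%:R * C * L `^ (alpha - 1)) by ring.
by apply: ler_wpM2r => //; rewrite !mulr_ge0 ?powR_ge0// ltW.
Qed.

(** The scales between delta and the block length m delta contribute to the
    mean over the block only a bounded amount: after integration against
    h^(- alpha - 1), the rounding error is a convergent integral at the small
    end of [delta, m delta], and the telescoped term one at the large end. *)
Lemma Theta_block_sum (y delta : R) (m : nat) : 0 < delta ->
  (0 < m)%N -> m%:R * delta <= 1 ->
  `|\sum_(l < m) (Theta alpha delta f (y + l%:R * delta) -
                  Theta alpha (m%:R * delta) f (y + l%:R * delta))| <=
  m%:R * (C * (alpha^-1 + 2 / (1 - alpha))).
Proof.
move=> d0 m0 L1; set L := m%:R * delta.
have mR0 : 0 < m%:R :> R by rewrite ltr0n.
have dL : delta <= L by rewrite ler_peMl ?(ltW d0)// ler1n.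
have L0 : 0 < L by rewrite mulr_gt0.
under eq_bigr do rewrite (Theta_split _ d0 dL L1) addrK.
rewrite -(Rintegral_bigsum (g := fun l => dd (y + l%:R * delta)))//; last first.
  by move=> l h; exact: continuous_divided_difference.
set A := m%:R * C * delta `^ alpha.
set B := m%:R * C * 2 * L `^ (alpha - 1).
have A0 : 0 <= A by rewrite !mulr_ge0 ?powR_ge0// ltW.
have B0 : 0 <= B by rewrite !mulr_ge0 ?powR_ge0// ltW.
apply: (@le_trans _ _ (\int[mu]_(h in `[delta, L])
   (A * h `^ (- alpha - 1) + B * h `^ (- alpha)))).
  apply: Rintegral_norm_le => //.
  - by move=> h h0; apply: (@continuous_bigsum _ (fun l => dd (y + l%:R * delta))) => l; exact: continuous_divided_difference.
  - by move=> h h0; apply: (@continuousD _ _ _ (fun h => A * h `^ (- alpha - 1))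
      (fun h => B * h `^ (- alpha))); exact: continuous_scale_powR.
  move=> h /andP[dh _]; have h0 : 0 < h by exact: lt_le_trans dh.
  under eq_bigr do rewrite divided_differenceE//.
  rewrite -mulr_suml normrM (ger0_norm (powR_ge0 _ _)).
  apply: (le_trans (ler_wpM2r (powR_ge0 _ _) (difference_block_sum y d0 h0 m0))).
  have -> : h `^ (- alpha) = h * h `^ (- alpha - 1).
    rewrite -{2}(powRr1 (ltW h0)) -powRD ?(gt_eqF h0) ?implybT//.
    by congr (_ `^ _); ring.
  by rewrite le_eqVlt; apply/orP; left; apply/eqP; rewrite /A /B -/L; ring.
rewrite RintegralD//; last 2 first.
- apply: (@integrable_continuous_pos _ (fun h => A * h `^ (- alpha - 1))) => // h.
  exact: continuous_scale_powR.
- apply: (@integrable_continuous_pos _ (fun h => B * h `^ (- alpha))) => // h.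
  exact: continuous_scale_powR.
rewrite !RintegralZl//; last 2 first.
- by apply: integrable_continuous_pos => // h h0; exact: continuous_powR_base.
- by apply: integrable_continuous_pos => // h h0; exact: continuous_powR_base.
apply: (le_trans (lerD (ler_wpM2l A0 (powRNB1_integral_le d0 dL))
  (ler_wpM2l B0 (powRN_integral_le d0 dL)))).
have e1 : delta `^ alpha * delta `^ (- alpha) = 1.
  by rewrite powRN divff// gt_eqF// powR_gt0.
have e2 : L `^ (alpha - 1) * L `^ (1 - alpha) = 1.
  rewrite -powRD; last by rewrite (gt_eqF L0) implybT.
  by rewrite (_ : alpha - 1 + (1 - alpha) = 0) ?powRr0//; ring.
have -> : A * (delta `^ (- alpha) / alpha) =
  m%:R * C * (delta `^ alpha * delta `^ (- alpha)) / alpha by rewrite /A; ring.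
have -> : B * (L `^ (1 - alpha) / (1 - alpha)) =
  m%:R * C * 2 * (L `^ (alpha - 1) * L `^ (1 - alpha)) / (1 - alpha).
  by rewrite /B; ring.
rewrite e1 e2 !mulr1 le_eqVlt; apply/orP; left; apply/eqP; ring.
Qed.

End holder_estimates.

(** * Dyadic martingales with bounded increments *)

Lemma sqr_le_of_norm (R : realDomainType) (a b : R) : `|a| <= b -> a ^+ 2 <= b ^+ 2.
Proof.
move=> ab; rewrite -real_normK ?num_real//.
by rewrite lerXn2r// nnegrE// (le_trans _ ab).
Qed.

Section dyadic_tree.
Variable R : realType.
Implicit Types (g u : R -> R) (d y x t : R) (m n : nat).
Notation mu := (@lebesgue_measure R).

Definition dyadic_block d m y : set R := `[y, y + 2 ^+ m * d[.

(** The mean of g over the mesh y, y + d, y + 2 d, ... of the 2^m points in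
    dyadic_block d m y.  The recursive form is the martingale property; the
    other form, as a normalized sum, is block_meanE. *)
Fixpoint block_mean g d m y : R :=
  if m is n.+1 then
    (block_mean g d n y + block_mean g d n (y + 2 ^+ n * d)) / 2
  else g y.

Lemma block_meanE g d m y :
  2 ^+ m * block_mean g d m y = \sum_(l < 2 ^ m) g (y + l%:R * d).
Proof.
elim: m y => [|m ih] y /=.
  by rewrite big_ord1 mul1r mul0r addr0.
rewrite expnS mul2n -addnn big_split_ord/= -ih.
under [in X in _ = _ + X]eq_bigr => l _.
  rewrite (_ : y + (2 ^ m + l)%:R * d = (y + 2 ^+ m * d) + l%:R * d); last first.
    by rewrite natrD natrX; ring.
  over.
by rewrite -ih exprS; field.
Qed.

Lemma dyadic_blockS d m y : 0 < d ->
  dyadic_block d m.+1 y =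
  dyadic_block d m y `|` dyadic_block d m (y + 2 ^+ m * d).
Proof.
move=> d0; have L0 : 0 < 2 ^+ m * d by rewrite mulr_gt0// exprn_gt0.
rewrite /dyadic_block exprS -mulrA.
set L := 2 ^+ m * d in L0 *.
apply/seteqP; split => x /=; rewrite !in_itv/=.
  move=> /andP[h1 h2]; have [h|h] := ltP x (y + L); [left|right].
    by rewrite h1.
  by rewrite /=; lra.
by case=> /andP[h1 h2]; apply/andP; split; lra.
Qed.

Lemma dyadic_block_disj d m y :
  dyadic_block d m y `&` dyadic_block d m (y + 2 ^+ m * d) = set0.
Proof.
rewrite -subset0 => x /=; rewrite /dyadic_block /= !in_itv/=.
by move=> [/andP[_ h1] /andP[h2 _]]; move: h1; rewrite ltNge h2.
Qed.

Lemma measurable_dyadic_block d m y : measurable (dyadic_block d m y).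
Proof. exact: measurable_itv. Qed.

Lemma dyadic_block_measure d m y : 0 < d ->
  mu (dyadic_block d m y) = (2 ^+ m * d)%:E.
Proof.
move=> d0; have L0 : 0 < 2 ^+ m * d by rewrite mulr_gt0// exprn_gt0.
rewrite /dyadic_block lebesgue_measure_itv/= lte_fin ltrDl L0.
by rewrite -EFinB addrAC subrr add0r.
Qed.

(** The event that the dyadic martingale started at the block of y, run down to
    blocks of length d, exceeds t in absolute value at some time.  It is a
    finite union of dyadic blocks, so its measure can be bounded by recursion
    on the tree of blocks. *)
Fixpoint exceedance g d t m y : set R :=
  (if t < `|block_mean g d m y| then dyadic_block d m y else set0) `|`
  (if m is n.+1 then exceedance g d t n y `|` exceedance g d t n (y + 2 ^+ n * d)
   else set0).

Lemma measurable_exceedance g d t m y : measurable (exceedance g d t m y).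
Proof.
elim: m y => [|m ih] y /=; apply: measurableU; try by apply: measurableU.
- by case: ifP => // _; exact: measurable_dyadic_block.
- exact: measurable0.
- by case: ifP => // _; exact: measurable_dyadic_block.
Qed.

Lemma exceedance_sub g d t m y : 0 < d ->
  exceedance g d t m y `<=` dyadic_block d m y.
Proof.
move=> d0; elim: m y => [|m ih] y /=.
  by rewrite setU0; case: ifP => _; [exact: subset_refl|exact: sub0set].
rewrite subUset; split; first by case: ifP => _; [exact: subset_refl|exact: sub0set].
by rewrite dyadic_blockS//; exact: setUSS.
Qed.

Lemma not_exceedance g d t m n y x : 0 < d -> (m <= n)%N ->
  dyadic_block d n y x -> ~ exceedance g d t n y x ->
  exists2 z, dyadic_block d m z x & `|block_mean g d m z| <= t.
Proof.
move=> d0; elim: n y => [|n ih] y.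
  rewrite leqn0 => /eqP -> yx h; exists y => //.
  by rewrite leNgt; apply/negP => ty; apply: h => /=; left; rewrite ty.
rewrite leq_eqVlt => /predU1P[->|]; last rewrite ltnS => mn.
  move=> yx h; exists y => //.
  by rewrite leNgt; apply/negP => ty; apply: h => /=; left; move: ty => /= ->.
rewrite dyadic_blockS// => -[yx|yx] h.
- by apply: (ih y) => // ex; apply: h => /=; right; left.
- by apply: (ih (y + 2 ^+ n * d)) => // ex; apply: h => /=; right; right.
Qed.

Section bounded_increments.
Variables (g : R -> R) (d D : R) (N : nat).
Hypothesis d_gt0 : 0 < d.
Hypothesis incr : forall m y, (m < N)%N ->
  `|block_mean g d m y - block_mean g d m.+1 y| <= D.

(** Since a mean is the midpoint of the means over the two halves, the two
    increments of the martingale are opposite. *)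
Lemma block_mean_children m y : (m < N)%N -> exists2 e, `|e| <= D &
  block_mean g d m y = block_mean g d m.+1 y + e /\
  block_mean g d m (y + 2 ^+ m * d) = block_mean g d m.+1 y - e.
Proof.
move=> mN; exists (block_mean g d m y - block_mean g d m.+1 y); first exact: incr.
split; first by ring.
by rewrite /=; field.
Qed.

(** Orthogonality of martingale increments: the mean of (a + e)^2 and (a - e)^2
    is a^2 + e^2, so each generation adds at most D^2 to the mean square. *)
Lemma integral_sqr_block (u : R -> R) (E : R) m y : (m <= N)%N ->
  measurable_fun setT u ->
  (forall z x, dyadic_block d 0 z x -> `|u x - g z| <= E) ->
  (\int[mu]_(x in dyadic_block d m y) (u x ^+ 2)%:E <=
   (2 ^+ m * d * (2 * (block_mean g d m y ^+ 2 + m%:R * D ^+ 2 + E ^+ 2)))%:E)%E.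
Proof.
move=> mN mu_ hu; elim: m mN y => [|m ih] mN y.
  apply: (@le_trans _ _ (\int[mu]_(x in dyadic_block d 0 y)
      (2 * (g y ^+ 2 + E ^+ 2))%:E)%E).
    apply: ge0_le_integral => //.
    - exact: measurable_dyadic_block.
    - by move=> x _; rewrite lee_fin sqr_ge0.
    - apply/measurable_EFinP; apply: measurable_funTS.
      exact: measurable_funX.
    - move=> x yx; rewrite lee_fin.
      have := hu y x yx; rewrite ler_norml => /andP[h1 h2].
      have : (u x - g y) ^+ 2 <= E ^+ 2.
        by have := hu y x yx; exact: sqr_le_of_norm.
      (* u^2 <= 2 (u - g)^2 + 2 g^2, the gap being (u - 2 g)^2 *)
      move: (sqr_ge0 (u x - 2 * g y)).
      nra.
  rewrite integral_cst//=; last exact: measurable_dyadic_block.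
  by rewrite dyadic_block_measure// -EFinM lee_fin mul0r addr0 mulrC.
have [e eD [e1 e2]] := block_mean_children y mN.
rewrite dyadic_blockS// ge0_integral_setU//; last 5 first.
- exact: measurable_dyadic_block.
- exact: measurable_dyadic_block.
- apply/measurable_EFinP; apply: measurable_funTS.
  exact: measurable_funX.
- by move=> x _; rewrite lee_fin sqr_ge0.
- by apply/disj_set2P; exact: dyadic_block_disj.
apply: (le_trans (leeD (ih (ltnW mN) _) (ih (ltnW mN) _))).
rewrite -EFinD lee_fin.
move: e1 e2; set a := block_mean g d m.+1 y => e1 e2; rewrite e1 e2.
have eD2 : e ^+ 2 <= D ^+ 2.
  exact: sqr_le_of_norm.
have L0 : 0 < 2 ^+ m * d by rewrite mulr_gt0// exprn_gt0.
rewrite (exprS 2 m) -(natr1 m) -(mulrA 2 _ d).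
set L := 2 ^+ m * d in L0 *.
rewrite -subr_ge0.
have -> : forall M : R, 2 * L * (2 * (a ^+ 2 + (M + 1) * D ^+ 2 + E ^+ 2)) -
  (L * (2 * ((a + e) ^+ 2 + M * D ^+ 2 + E ^+ 2)) +
   L * (2 * ((a - e) ^+ 2 + M * D ^+ 2 + E ^+ 2))) =
  L * (4 * (D ^+ 2 - e ^+ 2)) by move=> M; ring.
by rewrite !mulr_ge0 ?subr_ge0// ltW.
Qed.

(** The maximal form of the Azuma-Hoeffding inequality.  With
    P v = exp (lam v) + exp (- lam v), the recursion rests on
    P (a + e) + P (a - e) = P a * P e and on
    P e <= 2 exp (2 (lam e)^2); where the mean already exceeds t, the
    bound is at least the measure of the whole block. *)
Lemma exceedance_measure (lam t : R) m y : (m <= N)%N -> 0 <= lam ->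
  lam * D <= 1 / 2 ->
  (mu (exceedance g d t m y) <=
   (2 ^+ m * d * ((expR (lam * block_mean g d m y) +
                   expR (- (lam * block_mean g d m y))) *
      expR (- (lam * t) + m%:R * (2 * (lam * D) ^+ 2))))%:E)%E.
Proof.
move=> mN lam0 lamD.
have s0 : 0 <= 2 * (lam * D) ^+ 2 by rewrite mulr_ge0// sqr_ge0.
have large n z : t < `|block_mean g d n z| -> (mu (exceedance g d t n z) <=
   (2 ^+ n * d * ((expR (lam * block_mean g d n z) +
                   expR (- (lam * block_mean g d n z))) *
      expR (- (lam * t) + n%:R * (2 * (lam * D) ^+ 2))))%:E)%E.
  set a := block_mean g d n z => ta.
  apply: (@le_trans _ _ (mu (dyadic_block d n z))).
    apply: le_measure; rewrite ?inE; last exact: exceedance_sub.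
    - exact: measurable_exceedance.
    - exact: measurable_dyadic_block.
  rewrite dyadic_block_measure// lee_fin ler_peMr//.
    by rewrite mulr_ge0 ?exprn_ge0// ltW.
  apply: (@le_trans _ _ (expR (lam * `|a|) *
      expR (- (lam * t) + n%:R * (2 * (lam * D) ^+ 2)))).
    rewrite -expRD -[leLHS](@expR0 R) ler_expR addrA -mulrBr addr_ge0//.
      by rewrite mulr_ge0// subr_ge0 ltW.
    by rewrite mulr_ge0.
  apply: ler_wpM2r; first exact: expR_ge0.
  have [a0|a0] := ger0P a.
    by rewrite lerDl expR_ge0.
  by rewrite mulrN lerDr expR_ge0.
elim: m mN y => [|m ih] mN y.
  have [/large//|ta] := ltP t `|block_mean g d 0 y|.
  rewrite /= ltNge ta/= setU0 measure0 lee_fin.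
  by rewrite !mulr_ge0 ?addr_ge0 ?expR_ge0// ltW.
have [/large//|ta] := ltP t `|block_mean g d m.+1 y|.
have [e eD [e1 e2]] := block_mean_children y mN.
have -> : exceedance g d t m.+1 y =
    exceedance g d t m y `|` exceedance g d t m (y + 2 ^+ m * d).
  rewrite [LHS]/=; rewrite ifN ?set0U//.
  by rewrite -leNgt.
apply: (le_trans (measureU2 _ _ _)); try exact: measurable_exceedance.
apply: (le_trans (leeD (ih (ltnW mN) _) (ih (ltnW mN) _))).
rewrite -EFinD lee_fin.
move: e1 e2; set a := block_mean g d m.+1 y => e1 e2; rewrite e1 e2.
have L0 : 0 < 2 ^+ m * d by rewrite mulr_gt0// exprn_gt0.
rewrite (exprS 2 m) -(natr1 m) -(mulrA 2 _ d).
set S := 2 * (lam * D) ^+ 2 in s0 *.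
rewrite (_ : - (lam * t) + (m%:R + 1) * S = - (lam * t) + m%:R * S + S); last by ring.
rewrite (expRD (_ + _) S).
set L := 2 ^+ m * d in L0 *.
set X := expR (_ + _ * _).
have le_e : `|lam * e| <= 1 / 2.
  by rewrite normrM (ger0_norm lam0); apply: le_trans lamD; exact: ler_wpM2l.
have ple : expR (lam * e) + expR (- (lam * e)) <= 2 * expR S.
  apply: (le_trans (coshR_le_gauss le_e)).
  apply: ler_wpM2l => //; rewrite ler_expR; apply: ler_wpM2l => //.
  apply: sqr_le_of_norm; rewrite normrM (ger0_norm lam0); exact: ler_wpM2l.
have -> : L * ((expR (lam * (a + e)) + expR (- (lam * (a + e)))) * X) +
   L * ((expR (lam * (a - e)) + expR (- (lam * (a - e)))) * X) =
   L * X * (expR (lam * a) + expR (- (lam * a))) *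
   (expR (lam * e) + expR (- (lam * e))).
  rewrite !mulrBr !opprB !mulrDr !opprD !expRD.
  rewrite -(opprK (lam * e)) !opprK.
  ring.
have -> : 2 * L * ((expR (lam * a) + expR (- (lam * a))) *
   (X * expR S)) =
   L * X * (expR (lam * a) + expR (- (lam * a))) *
   (2 * expR S) by ring.
apply: ler_wpM2l => //.
by rewrite !mulr_ge0 ?addr_ge0 ?expR_ge0// ltW.
Qed.

End bounded_increments.
End dyadic_tree.

(** * The martingale of block means of Theta, and the L^2 bound *)

Section dyadic_scales.
Variable R : realType.
Implicit Types (eps : R).

Lemma ln2_ge_half : 1 / 2 <= ln 2 :> R.
Proof.
have := @le_ln1Dx R (- (1 / 2)).
have -> : 1 + - (1 / 2) = 2^-1 :> R by field.
rewrite lnV ?posrE// => /(_ ltac:(lra)); lra.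
Qed.

Lemma dyadic_scale eps : 0 < eps -> eps <= 1 ->
  exists N, 2 ^- N.+1 <= eps /\ eps <= 2 ^- N.
Proof.
move=> e0 e1.
have ex : exists n, 2 ^- n.+1 <= eps.
  exists (Num.truncn eps^-1).
  rewrite -[leRHS]invrK lef_pV2 ?posrE ?exprn_gt0 ?invr_gt0//.
  apply: ltW; apply: (lt_le_trans (truncnS_gt _)).
  by rewrite -natrX ler_nat ltnW// ltn_expl.
exists (ex_minn ex); case: ex_minnP => -[|N] hN hmin; split=> //.
  by rewrite expr0 invr1.
by rewrite leNgt; apply/negP => /ltW /hmin; rewrite ltnn.
Qed.

Lemma ln_inv_ge eps N : 0 < eps -> eps <= 2 ^- N -> N%:R / 2 <= ln (1 / eps).
Proof.
move=> e0 eN.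
have h : 2 ^+ N <= 1 / eps.
  rewrite div1r -[leLHS]invrK lef_pV2 ?posrE ?invr_gt0 ?exprn_gt0//.
have : ln (2 ^+ N) <= ln (1 / eps).
  by rewrite ler_ln ?posrE ?exprn_gt0 ?divr_gt0.
rewrite lnXn// -(mulr_natl (ln 2)); apply: le_trans.
by apply: ler_wpM2l => //; have := ln2_ge_half; rewrite div1r.
Qed.

End dyadic_scales.

(** In units of the Hoelder constant: the distance between a block mean and
    Theta at the scale of the block (block_mean_Theta). *)
Definition approximation_constant (R : realType) (alpha : R) : R :=
  3 / alpha + 2 / (1 - alpha).

(** In units of the Hoelder constant: the size of the martingale increments
    (block_mean_increment), i.e. two approximations and one octave. *)
Definition increment_constant (R : realType) (alpha : R) : R :=
  2 * approximation_constant alpha + 2.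

Section theta_tree.
Variables (R : realType) (alpha C : R) (f : R -> R).
Hypotheses (alpha_gt0 : 0 < alpha) (alpha_lt1 : alpha < 1) (C_ge0 : 0 <= C).
Hypothesis hf : forall x y : R, `|f x - f y| <= C * `|x - y| `^ alpha.

Notation mu := (@lebesgue_measure R).
Let E := C * approximation_constant alpha.
Let D := C * increment_constant alpha.

Lemma approximation_constant_ge0 : 0 <= approximation_constant alpha.
Proof.
by rewrite addr_ge0// divr_ge0// ?subr_ge0 ltW.
Qed.

Lemma increment_constant_gt0 : 0 < increment_constant alpha.
Proof. by rewrite ltr_wpDl// mulr_ge0// approximation_constant_ge0. Qed.

(** The block means of Theta at the finest scale delta form a martingale which
    stays within a constant of Theta at the scale of the block: scales below
    the block length cancel in the mean (Theta_block_sum), scales above it do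
    not vary on the block (Theta_holder). *)
Lemma block_mean_Theta (delta : R) m y x : 0 < delta -> 2 ^+ m * delta <= 1 ->
  dyadic_block delta m y x ->
  `|block_mean (Theta alpha delta f) delta m y -
    Theta alpha (2 ^+ m * delta) f x| <= E.
Proof.
move=> d0 L1; rewrite /dyadic_block /= in_itv/= => /andP[yx xy].
set L := 2 ^+ m * delta in L1 xy *.
have P0 : 0 < 2 ^+ m :> R by rewrite exprn_gt0.
have L0 : 0 < L by rewrite mulr_gt0.
have Pnat : (2 ^ m)%:R = 2 ^+ m :> R by rewrite natrX.
have LE : (2 ^ m)%:R * delta = L by rewrite Pnat.
rewrite -(ler_pM2l P0) -[X in X * `|_|](ger0_norm (ltW P0)) -normrM mulrBr block_meanE.
have -> : 2 ^+ m * Theta alpha L f x = \sum_(l < 2 ^ m) Theta alpha L f x.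
  by rewrite sumr_const card_ord -(mulr_natl (Theta _ _ _ _)) Pnat.
rewrite -sumrB.
have -> : \sum_(l < 2 ^ m) (Theta alpha delta f (y + l%:R * delta) - Theta alpha L f x) =
  \sum_(l < 2 ^ m) (Theta alpha delta f (y + l%:R * delta) -
                    Theta alpha ((2 ^ m)%:R * delta) f (y + l%:R * delta)) +
  \sum_(l < 2 ^ m) (Theta alpha L f (y + l%:R * delta) - Theta alpha L f x).
  rewrite -big_split/=; apply: eq_bigr => l _; rewrite LE; ring.
apply: (le_trans (ler_normD _ _)).
have b1 := Theta_block_sum alpha_gt0 alpha_lt1 C_ge0 hf y d0 (expn_gt0 2 m).
rewrite LE Pnat in b1; have {}b1 := b1 L1; rewrite -LE in b1.
apply: (le_trans (lerD b1 (ler_norm_sum _ _ _))).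
have b2 : \sum_(l < 2 ^ m) `|Theta alpha L f (y + l%:R * delta) - Theta alpha L f x| <=
    \sum_(l < 2 ^ m) (2 * C / alpha).
  apply: ler_sum => l _.
  apply: (le_trans (Theta_holder alpha_gt0 C_ge0 hf _ _ L0 L1)).
  rewrite -[leRHS]mulr1; apply: ler_wpM2l.
    by rewrite divr_ge0 ?mulr_ge0// ltW.
  rewrite powRN ler_pdivrMr ?powR_gt0// mul1r.
  apply: ge0_ler_powR; [exact: ltW|by rewrite nnegrE|by rewrite nnegrE ltW|].
  have l0 : 0 <= l%:R * delta by rewrite mulr_ge0// ltW.
  have lL : l%:R * delta <= L.
    by rewrite -LE ler_wpM2r ?(ltW d0)// ler_nat ltnW.
  by rewrite ler_norml; apply/andP; split; lra.
apply: (le_trans (lerD (lexx _) b2)).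
rewrite sumr_const card_ord -(mulr_natl (2 * C / alpha)) Pnat /E /approximation_constant.
by rewrite le_eqVlt; apply/orP; left; apply/eqP; ring.
Qed.

Lemma block_mean_increment (delta : R) m y : 0 < delta ->
  2 ^+ m.+1 * delta <= 1 ->
  `|block_mean (Theta alpha delta f) delta m y -
    block_mean (Theta alpha delta f) delta m.+1 y| <= D.
Proof.
move=> d0 L1.
have L0 : 0 < 2 ^+ m * delta by rewrite mulr_gt0// exprn_gt0.
have L2 : 2 ^+ m.+1 * delta = 2 * (2 ^+ m * delta) by rewrite exprS mulrA.
have mL : 2 ^+ m * delta <= 1.
  by apply: le_trans L1; rewrite L2 ler_peMl ?ler1n// ltW.
have y1 : dyadic_block delta m y y by rewrite /dyadic_block /= in_itv/= lexx ltrDl.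
have y2 : dyadic_block delta m.+1 y y.
  by rewrite /dyadic_block /= in_itv/= lexx ltrDl L2 mulr_gt0.
have h1 := block_mean_Theta d0 mL y1.
have h2 := block_mean_Theta d0 L1 y2.
have h3 : `|Theta alpha (2 ^+ m * delta) f y - Theta alpha (2 ^+ m.+1 * delta) f y| <= 2 * C.
  by apply: (Theta_octave alpha_gt0 alpha_lt1 C_ge0 hf) => //; rewrite L2 // ler_peMl ?ler1n// ltW.
rewrite distrC in h2.
move: h1 h2 h3.
set A := block_mean _ _ _ _; set B := block_mean _ _ _ _.
set S := Theta _ _ _ _; set T := Theta _ _ _ _ => h1 h2 h3.
have -> : A - B = (A - S) + (S - T) + (T - B) by ring.
apply: (le_trans (ler_normD _ _)).
apply: (le_trans (lerD (ler_normD _ _) h2)).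
apply: (le_trans (lerD (lerD h1 h3) (lexx _))).
rewrite /E /D /increment_constant le_eqVlt; apply/orP; left; apply/eqP; ring.
Qed.

(** The martingale starts near 0 because Theta at scale 1 vanishes. *)
Lemma root_block_mean N y :
  `|block_mean (Theta alpha (2 ^- N) f) (2 ^- N) N y| <= E.
Proof.
have d0 : 0 < 2 ^- N :> R by rewrite invr_gt0 exprn_gt0.
have L1 : 2 ^+ N * 2 ^- N = 1 :> R by rewrite divff// gt_eqF// exprn_gt0.
have y1 : dyadic_block (2 ^- N) N y y.
  by rewrite /dyadic_block /= in_itv/= lexx ltrDl L1 ltr01.
have := @block_mean_Theta (2 ^- N) N y y d0.
by rewrite L1 Theta1 subr0; apply.
Qed.

Lemma approximation_le_increment : E <= D.
Proof.
apply: ler_wpM2l => //; rewrite /increment_constant.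
have := approximation_constant_ge0; lra.
Qed.

Lemma measurable_Theta eps : 0 < eps -> eps <= 1 ->
  measurable_fun setT (Theta alpha eps f).
Proof.
move=> e0 e1; apply: continuous_measurable_fun.
apply: (@sub_powR_continuous _ alpha (2 * C / alpha * eps `^ (- alpha))) => //.
  by rewrite mulr_ge0 ?powR_ge0// divr_ge0 ?mulr_ge0// ltW.
move=> x y; rewrite -mulrA [eps `^ _ * _]mulrC.
exact: Theta_holder.
Qed.

Lemma Theta_dyadic_approx eps N x : 2 ^- N.+1 <= eps -> eps <= 2 ^- N ->
  `|Theta alpha eps f x - Theta alpha (2 ^- N) f x| <= 2 * C.
Proof.
move=> e1 e2.
have d0 : 0 < 2 ^- N.+1 :> R by rewrite invr_gt0 exprn_gt0.
have e0 : 0 < eps by exact: lt_le_trans e1.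
apply: (Theta_octave alpha_gt0 alpha_lt1 C_ge0 hf) => //.
  have -> : 2 ^- N = 2 * 2 ^- N.+1 :> R.
    by rewrite exprS invfM mulrA divff// mul1r.
  exact: ler_wpM2l.
by rewrite invf_le1 ?exprn_gt0// exprn_ege1// ler1n.
Qed.

(** With 2^-(N+1) <= eps <= 2^-N, the N generations below a unit block
    contribute at most N D^2 to the mean square, and N is comparable to
    log (1 / eps). *)
Lemma integral_Theta_unit (a eps : R) : 0 < eps -> eps < 1 / 2 ->
  (\int[mu]_(x in `[a, (a + 1)%R[) (Theta alpha eps f x ^+ 2)%:E <=
   (12 * D ^+ 2 * ln (1 / eps))%:E)%E.
Proof.
move=> e0 e12; have e1 : eps <= 1 by lra.
have [N [eN1 eN]] := dyadic_scale e0 e1.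
have N0 : (0 < N)%N.
  by case: N eN1 {eN} => // h; move: e12; rewrite ltNge div1r -[2]expr1 h.
have d0 : 0 < 2 ^- N :> R by rewrite invr_gt0 exprn_gt0.
have L1 : 2 ^+ N * 2 ^- N = 1 :> R by rewrite divff// gt_eqF// exprn_gt0.
have incr m y : (m < N)%N ->
    `|block_mean (Theta alpha (2 ^- N) f) (2 ^- N) m y -
      block_mean (Theta alpha (2 ^- N) f) (2 ^- N) m.+1 y| <= D.
  move=> mN; apply: block_mean_increment => //.
  by rewrite -[leRHS]L1 ler_pM2r// ler_weXn2l// ler1n.
have approx z x : dyadic_block (2 ^- N) 0 z x ->
    `|Theta alpha eps f x - Theta alpha (2 ^- N) f z| <= D.
  move=> zx.
  have d1 : 2 ^+ 0 * 2 ^- N <= 1 :> R.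
    by rewrite mul1r invf_le1 ?exprn_gt0// exprn_ege1// ler1n.
  have h1 := block_mean_Theta d0 d1 zx.
  rewrite mul1r /= distrC in h1.
  have h2 := Theta_dyadic_approx x eN1 eN.
  have -> : Theta alpha eps f x - Theta alpha (2 ^- N) f z =
    (Theta alpha eps f x - Theta alpha (2 ^- N) f x) +
    (Theta alpha (2 ^- N) f x - Theta alpha (2 ^- N) f z) by ring.
  apply: (le_trans (ler_normD _ _)); apply: (le_trans (lerD h2 h1)).
  rewrite /E /D /increment_constant (_ : 2 * C + _ = C * (approximation_constant alpha + 2)); last by ring.
  apply: ler_wpM2l => //; have := approximation_constant_ge0; lra.
have := integral_sqr_block d0 incr a (leqnn N) (measurable_Theta e0 e1) approx.
rewrite /dyadic_block L1 mul1r => /le_trans; apply.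
rewrite lee_fin.
have h1 : block_mean (Theta alpha (2 ^- N) f) (2 ^- N) N a ^+ 2 <= D ^+ 2.
  by apply: sqr_le_of_norm; apply: (le_trans (root_block_mean N a)); exact: approximation_le_increment.
have h2 : N%:R <= 2 * ln (1 / eps) by have := ln_inv_ge e0 eN; lra.
have h3 : 1 <= N%:R :> R by rewrite ler1n.
have D2 : 0 <= D ^+ 2 by exact: sqr_ge0.
apply: (@le_trans _ _ (2 * (N%:R + 2) * D ^+ 2)).
  by move: h1; set X := block_mean _ _ _ _ ^+ 2; lra.
rewrite [leRHS]mulrAC; apply: ler_wpM2r => //; lra.
Qed.

End theta_tree.

(** * Intervals of length one, the Hoelder seminorm, upper limits *)

Section interval_of_length_one.
Variables (R : realType).
Notation mu := (@lebesgue_measure R).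

Lemma interval_length_le1 (I : set R) (x y : R) : is_interval I -> mu I = 1%E ->
  I x -> I y -> y - x <= 1.
Proof.
move=> Ii I1 Ix Iy; have [yx|xy] := leP y x; first by lra.
have sub : `[x, y]%classic `<=` I.
  by move=> z /=; rewrite in_itv/= => xzy; exact: (Ii x y).
have : (mu `[x, y]%classic <= mu I)%E.
  apply: le_measure => //; rewrite inE; first exact: measurable_itv.
  exact: is_interval_measurable.
by rewrite I1 lebesgue_measure_itv/= lte_fin xy -EFinB lee_fin.
Qed.

(** An interval of length one around x is contained in [x - 1, x + 1], hence in
    three consecutive half-open unit intervals. *)
Lemma interval_length1_integral_le (u : R -> R) (B : R) (I : set R) :
  is_interval I -> mu I = 1%E -> measurable_fun setT u ->
  (forall a, (\int[mu]_(x in `[a, (a + 1)%R[) (u x ^+ 2)%:E <= B%:E)%E) ->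
  (\int[mu]_(x in I) (u x ^+ 2)%:E <= (3 * B)%:E)%E.
Proof.
move=> Ii I1 mu_ hB.
have [x Ix] : I !=set0.
  apply/set0P; apply/eqP => I0; move: I1; rewrite I0 measure0.
  by move/eqP; rewrite eqe; rewrite eq_sym oner_eq0.
pose U : set R := (`[x - 1, (x - 1) + 1[ `|` `[x, x + 1[) `|`
    `[x + 1, (x + 1) + 1[.
have sub : I `<=` U.
  move=> y Iy.
  have h1 := interval_length_le1 Ii I1 Ix Iy.
  have h2 := interval_length_le1 Ii I1 Iy Ix.
  clear I1 hB mu_; rewrite /U /= !in_itv/=.
  have [yx|xy] := ltP y x; first by left; left; apply/andP; split; lra.
  have [yx1|xy1] := ltP y (x + 1); first by left; right.
  by right; apply/andP; split; lra.
apply: (@le_trans _ _ (\int[mu]_(x in U) (u x ^+ 2)%:E)%E).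
  apply: ge0_subset_integral => //.
  - exact: is_interval_measurable.
  - by apply: measurableU; [apply: measurableU|]; exact: measurable_itv.
  - by apply/measurable_EFinP; apply: measurable_funTS; exact: measurable_funX.
  - by move=> y _; rewrite lee_fin sqr_ge0.
rewrite /U ge0_integral_setU//; last 4 first.
- by apply: measurableU; exact: measurable_itv.
- by apply/measurable_EFinP; apply: measurable_funTS; exact: measurable_funX.
- by move=> y _; rewrite lee_fin sqr_ge0.
- apply/disj_set2P; rewrite -subset0 => y /=; rewrite !in_itv/=.
  clear I1 hB mu_.
  by move=> [[/andP[_ h1]|/andP[_ h1]] /andP[h2 _]]; lra.
rewrite ge0_integral_setU//; last 3 first.
- by apply/measurable_EFinP; apply: measurable_funTS; exact: measurable_funX.
- by move=> y _; rewrite lee_fin sqr_ge0.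
- apply/disj_set2P; rewrite -subset0 => y /=; rewrite !in_itv/=.
  clear I1 hB mu_.
  by move=> [/andP[_ h1] /andP[h2 _]]; lra.
apply: (le_trans (leeD (leeD (hB _) (hB _)) (hB _))).
rewrite -!EFinD lee_fin le_eqVlt; apply/orP; left; apply/eqP; ring.
Qed.

End interval_of_length_one.

Section holder_norm_theory.
Variables (R : realType) (alpha : R) (f : R -> R).
Hypothesis hf : holder_class alpha f.

Lemma holder_norm_ge0 : 0 <= holder_norm alpha f.
Proof. by apply: lb_le_inf => // C [/ltW]. Qed.

Lemma holder_normP x y : `|f x - f y| <= holder_norm alpha f * `|x - y| `^ alpha.
Proof.
have [C0 [C00 hC0]] := hf.
have := powR_ge0 `|x - y| alpha; rewrite le_eqVlt => /predU1P[p0|p0].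
  by rewrite -p0 mulr0; have := hC0 x y; rewrite -p0 mulr0.
rewrite -ler_pdivrMr//; apply: lb_le_inf => // C [_ hC].
by rewrite ler_pdivrMr.
Qed.

End holder_norm_theory.

Section limsup.
Variable R : realType.

Lemma limf_esup_at_right_le (h : R -> R) (B e0 : R) : 0 < e0 ->
  (forall e, 0 < e -> e < e0 -> h e <= B) ->
  (limf_esup (fun e => (h e)%:E) (at_right (0 : R)) <= B%:E)%E.
Proof.
move=> e00 hB; rewrite limf_esupE.
apply: (@le_trans _ _ (ereal_sup ((fun e => (h e)%:E) @` [set e | 0 < e < e0]))).
  apply: ereal_inf_lbound; exists [set e | 0 < e < e0] => //.
  near=> e; rewrite /=; apply/andP; split; near: e.
    exact: nbhs_right_gt.
  exact: nbhs_right_lt.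
by apply: ge_ereal_sup => _ [e /= /andP[e1 e2] <-]; rewrite lee_fin hB.
Unshelve. all: by end_near.
Qed.

(** Summability by comparison with a telescoping series; it will serve for
    the series of 1 / j^2. *)
Lemma telescoping_nneseries_lty (u : nat -> \bar R) (v : nat -> R) :
  (forall n, 0 <= u n)%E -> (forall n, 0 <= v n) ->
  (forall n, u n <= (v n - v n.+1)%:E)%E -> (\sum_(n <oo) u n < +oo)%E.
Proof.
move=> u0 v0 uv; apply: (@le_lt_trans _ _ (v 0)%:E); last exact: ltry.
apply: lime_le; first exact: is_cvg_nneseries.
apply: nearW => n.
apply: (@le_trans _ _ (v 0%N - v n)%:E); last by rewrite lee_fin gerBl.
elim: n => [|n ih]; first by rewrite big_geq// subrr.
rewrite big_nat_recr//=; apply: (le_trans (leeD ih (uv n))).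
by rewrite -EFinD lee_fin addrA subrK.
Qed.

Lemma negligible_of_unit_intervals (P : set R) :
  (forall a, (@lebesgue_measure R).-negligible (`[a, a + 1[ `&` P)) ->
  (@lebesgue_measure R).-negligible P.
Proof.
move=> h.
pose G (n : nat) := (`[n%:R, n%:R + 1[ `&` P) `|`
   (`[- n.+1%:R, - n.+1%:R + 1[ `&` P) : set R.
have GN : (@lebesgue_measure R).-negligible (\bigcup_n G n).
  by apply: negligible_bigcup => n; apply: negligibleU; exact: h.
apply: negligibleS GN.
move=> x Px.
have : (Num.floor x)%:~R <= x < (Num.floor x)%:~R + 1.
  by have := floor_itv x; rewrite intrD.
case: (Num.floor x) => n hn; exists n => //; [left|right]; split => //=.
Qed.

End limsup.

(** Along the horizons N = 2^j and for u = log (1 / eps) >= N / 4, the quantity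
    log j is at most twice log log u: this is where the third logarithm of
    1 / eps comes from. *)
Lemma iterated_log_bounds (R : realType) (j : nat) (u : R) : (8 <= j)%N ->
  2 ^+ j / 4 <= u ->
  2 ^+ j * ln j%:R <= 8 * (u * ln (ln u)) /\ 1 <= u * ln (ln u).
Proof.
move=> j8 hu.
have jR : 8 <= j%:R :> R by rewrite ler_nat.
have ej : 2 ^+ j / 4 = 2 ^+ (j - 2) :> R.
  rewrite -[in LHS](subnK (leq_trans _ j8 : 2 <= j)%N)// exprD.
  by rewrite -[RHS]mulr1 -mulrA; congr (_ * _); field.
have u0 : 0 < u by apply: lt_le_trans hu; rewrite divr_gt0 ?exprn_gt0.
have u64 : 64 <= u.
  apply: le_trans hu; rewrite ej (_ : 64 = 2 ^+ 6); last by ring.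
  by rewrite ler_weXn2l ?ler1n// leq_subRL ?(leq_trans _ j8).
have lnu : (j%:R - 2) / 2 <= ln u.
  apply: (@le_trans _ _ (ln (2 ^+ (j - 2)))).
    rewrite lnXn// -(mulr_natl (ln 2)) natrB ?(leq_trans _ j8)//.
    by apply: ler_wpM2l; [lra|have := @ln2_ge_half R; rewrite div1r].
  by rewrite ler_ln ?posrE ?exprn_gt0// -ej.
have w : ln j%:R <= 2 * ln (ln u).
  have h : ln j%:R <= 2 * ln ((j%:R - 2) / 2 : R).
    rewrite mulr_natl -lnXn; last by lra.
    rewrite ler_ln ?posrE ?exprn_gt0//; [nra|lra|lra].
  apply: (le_trans h); apply: ler_wpM2l => //.
  by rewrite ler_ln ?posrE//; lra.
have lnj : 1 / 2 <= ln j%:R :> R.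
  apply: (le_trans (@ln2_ge_half R)); rewrite ler_ln ?posrE//; lra.
have P4 : 2 ^+ j <= 4 * u by move: hu; rewrite ler_pdivrMr// mulrC.
split; last by nra.
apply: (@le_trans _ _ (4 * u * (2 * ln (ln u)))).
  by apply: ler_pM => //; lra.
by rewrite le_eqVlt; apply/orP; left; apply/eqP; ring.
Qed.

(** * The iterated logarithm bound *)

Section iterated_logarithm.
Variables (R : realType) (alpha C : R) (f : R -> R).
Hypotheses (alpha_gt0 : 0 < alpha) (alpha_lt1 : alpha < 1) (C_gt0 : 0 < C).
Hypothesis hf : forall x y : R, `|f x - f y| <= C * `|x - y| `^ alpha.

Notation mu := (@lebesgue_measure R).
Let D := C * increment_constant alpha.

(** The factor 4 makes the exponent in the maximal inequality equal to
    - 2 log j, hence the exceedance probabilities summable. *)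
Definition lil_threshold (j : nat) : R := 4 * D * Num.sqrt (2 ^+ j * ln j%:R).

Definition lil_exceedance (a : R) (j : nat) : set R :=
  exceedance (Theta alpha (2 ^- (2 ^ j)) f) (2 ^- (2 ^ j)) (lil_threshold j) (2 ^ j) a.

Let D_gt0 : 0 < D.
Proof. by rewrite mulr_gt0// increment_constant_gt0. Qed.

(** The maximal inequality for N = 2^j and the optimal parameter
    lam = sqrt (log j / N) / D gives exp (- 4 log j + 2 log j) = 1 / j^2. *)
Lemma lil_exceedance_measure a j : (4 <= j)%N ->
  (mu (lil_exceedance a j) <= (4 / j%:R ^+ 2)%:E)%E.
Proof.
move=> j4; set N := (2 ^ j)%N.
have jR : 4 <= j%:R :> R by rewrite ler_nat.
have j0 : 0 < j%:R :> R by lra.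
have NR : N%:R = 2 ^+ j :> R by rewrite natrX.
have P0 : 0 < 2 ^+ j :> R by rewrite exprn_gt0.
have d0 : 0 < 2 ^- N :> R by rewrite invr_gt0 exprn_gt0.
have L1 : 2 ^+ N * 2 ^- N = 1 :> R by rewrite divff// gt_eqF// exprn_gt0.
have incr m y : (m < N)%N ->
    `|block_mean (Theta alpha (2 ^- N) f) (2 ^- N) m y -
      block_mean (Theta alpha (2 ^- N) f) (2 ^- N) m.+1 y| <= D.
  move=> mN; apply: (block_mean_increment alpha_gt0 alpha_lt1 (ltW C_gt0) hf) => //.
  by rewrite -[leRHS]L1 ler_pM2r// ler_weXn2l// ler1n.
have l0 : 0 <= ln j%:R :> R by rewrite ln_ge0//; lra.
pose s : R := Num.sqrt (ln j%:R / 2 ^+ j).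
have s0 : 0 <= s by exact: sqrtr_ge0.
have s2 : s ^+ 2 = ln j%:R / 2 ^+ j by rewrite sqr_sqrtr// divr_ge0// ltW.
have s_half : s <= 1 / 2.
  (* s^2 = log j / 2^j < j / 2^j, which is at most 1 / 4 from j = 4 on *)
  have jP : (4 * j <= 2 ^ j)%N.
    elim: j j4 {jR j0 NR P0 incr l0 s s0 s2 L1 d0 N} => // j ih; rewrite leq_eqVlt => /predU1P[<-//|].
    rewrite ltnS => /[dup] j4 /ih h; rewrite expnS mul2n -addnn mulnS.
    by apply: leq_add => //; apply: leq_trans h; rewrite leq_pmulr// (leq_trans _ j4).
  have {}jP : 4 * j%:R <= 2 ^+ j :> R by rewrite -natrX -natrM ler_nat.
  have : s ^+ 2 <= (1 / 2) ^+ 2.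
    rewrite s2 ler_pdivrMr//; have := ln_sublinear j0; lra.
  by rewrite ler_pXn2r// nnegrE//; lra.
pose lam := s / D.
have lam0 : 0 <= lam by rewrite divr_ge0// ltW.
have lamD : lam * D = s by rewrite /lam -mulrA mulVf ?mulr1// gt_eqF.
have := @exceedance_measure _ _ _ _ N d0 incr lam (lil_threshold j) N a (leqnn N) lam0.
rewrite lamD => /(_ s_half) /le_trans; apply.
rewrite lee_fin L1 mul1r NR s2.
have -> : lam * lil_threshold j = 4 * ln j%:R.
  rewrite /lil_threshold (_ : lam * _ = 4 * (lam * D) * Num.sqrt (2 ^+ j * ln j%:R)); last by ring.
  rewrite lamD -mulrA /s -sqrtrM ?divr_ge0 ?(ltW P0)//.
  rewrite (_ : _ / _ * _ = ln j%:R ^+ 2); last by field; rewrite gt_eqF.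
  by rewrite sqrtr_sqr ger0_norm.
have -> : - (4 * ln j%:R) + 2 ^+ j * (2 * (ln j%:R / 2 ^+ j)) = - (ln (j%:R ^+ 2)) :> R.
  by rewrite lnXn// -(mulr_natl (ln _)); field; rewrite gt_eqF.
rewrite (expRN (ln _)) lnK ?posrE ?exprn_gt0//.
apply: ler_wpM2r; first by rewrite invr_ge0 exprn_ge0// ltW.
set A := block_mean _ _ _ _.
have hA : `|lam * A| <= 1 / 2.
  apply: le_trans s_half; rewrite normrM (ger0_norm lam0) -lamD.
  apply: ler_wpM2l => //.
  apply: (le_trans (root_block_mean alpha_gt0 alpha_lt1 (ltW C_gt0) hf N a)).
  exact: (approximation_le_increment alpha_gt0 alpha_lt1 (ltW C_gt0)).
apply: (le_trans (coshR_le_gauss hA)).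
have h1 : (lam * A) ^+ 2 <= (1 / 2) ^+ 2 by exact: sqr_le_of_norm.
have h2 : expR (2 * (lam * A) ^+ 2) <= expR (1 / 2) by rewrite ler_expR; lra.
have := @expR_le_quadratic R (1 / 2).
rewrite ger0_norm ?divr_ge0// => /(_ (lexx _)); lra.
Qed.

Lemma lil_exceedance_limsup0 a :
  mu (lim_sup_set (fun j => lil_exceedance a (j + 4))) = 0%E.
Proof.
apply: lim_sup_set_cvg0; first by move=> j; exact: measurable_exceedance.
apply: (@telescoping_nneseries_lty _ _ (fun j => 4 / (j + 3)%:R)) => // n.
apply: (le_trans (lil_exceedance_measure _ (leq_addl _ _))).
rewrite lee_fin /= (natrD _ n 4) (natrD _ n 3) (natrD _ n.+1 3).
set x : R := n%:R.
have x0 : 0 <= x by rewrite ler0n.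
have -> : 4 / (x + 3) - 4 / (n.+1%:R + 3) = 4 / ((x + 3) * (x + 4)).
  rewrite -natr1 -/x; field; apply/andP; split; apply: lt0r_neq0; lra.
apply: ler_wpM2l => //; rewrite lef_pV2 ?posrE; nra.
Qed.

(** If x avoids the exceedance sets from J on, then a small eps is treated
    with its dyadic scale 2^-k and the first horizon 2^j > k: the block mean at
    scale 2^-k is below the threshold, and differs from Theta by at most D. *)
Lemma Theta_iterated_log_off_exceedance a x J :
  a <= x < a + 1 -> (8 <= J)%N ->
  (forall j, (J <= j)%N -> ~ lil_exceedance a j x) ->
  forall eps, 0 < eps -> eps < 2 ^- (2 ^ J) ->
  `|Theta alpha eps f x| <=
    13 * D * Num.sqrt (ln (1 / eps) * ln (ln (ln (1 / eps)))).
Proof.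
move=> ax J8 hJ eps e0 eJ.
have e1 : eps <= 1.
  apply: (le_trans (ltW eJ)).
  by rewrite invf_le1 ?exprn_gt0// exprn_ege1// ler1n.
have [k [ek1 ek]] := dyadic_scale e0 e1.
have Jk : (2 ^ J <= k)%N.
  have : 2 ^- k.+1 < 2 ^- (2 ^ J) :> R by exact: le_lt_trans eJ.
  by rewrite ltf_pV2 ?posrE ?exprn_gt0// ltr_eXn2l ?ltr1n.
have k0 : (0 < k)%N by apply: leq_trans Jk; rewrite expn_gt0.
(* the first horizon beyond k, so that 2^(j-1) <= k < 2^j *)
pose j := (trunc_log 2 k).+1.
have /andP[kj1 kj] : (2 ^ trunc_log 2 k <= k < 2 ^ j)%N by exact: trunc_log_bounds.
have Jj : (J <= j)%N by apply: leqW; exact: trunc_log_max.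
have j8 : (8 <= j)%N by exact: leq_trans J8 Jj.
set N := (2 ^ j)%N in kj.
have d0 : 0 < 2 ^- N :> R by rewrite invr_gt0 exprn_gt0.
have L1 : 2 ^+ N * 2 ^- N = 1 :> R by rewrite divff// gt_eqF// exprn_gt0.
have Lk : 2 ^+ (N - k) * 2 ^- N = 2 ^- k :> R.
  have -> : 2 ^+ N = 2 ^+ (N - k) * 2 ^+ k :> R by rewrite -exprD subnK// ltnW.
  by field; rewrite !gt_eqF ?exprn_gt0.
have ax' : dyadic_block (2 ^- N) N a x.
  by rewrite /dyadic_block /= in_itv/= L1.
have [z zx hz] := not_exceedance d0 (leq_subr k N) ax' (hJ j Jj).
have k1 : 2 ^- k <= 1 :> R by rewrite invf_le1 ?exprn_gt0// exprn_ege1// ler1n.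
have := block_mean_Theta alpha_gt0 alpha_lt1 (ltW C_gt0) hf d0 _ zx.
rewrite Lk => /(_ k1); move: hz.
set A := block_mean _ _ _ _ => hz hA.
have hT := Theta_dyadic_approx alpha_gt0 alpha_lt1 (ltW C_gt0) hf x ek1 ek.
set u := ln (1 / eps).
have hu : 2 ^+ j / 4 <= u.
  apply: le_trans (ln_inv_ge e0 ek).
  have : (2 ^ trunc_log 2 k)%:R <= k%:R :> R by rewrite ler_nat.
  by rewrite natrX /j exprS; lra.
have [b1 b2] := iterated_log_bounds j8 hu.
set w := u * _ in b1 b2 *.
have w0 : 0 <= w by lra.
have w1 : 1 <= Num.sqrt w by rewrite -[leLHS](@sqrtr1 R) ler_sqrt.
have ht : lil_threshold j <= 4 * D * (3 * Num.sqrt w).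
  rewrite /lil_threshold; apply: ler_wpM2l; first by rewrite mulr_ge0// ltW.
  have -> : 3 * Num.sqrt w = Num.sqrt (9 * w).
    have -> : 9 = 3 ^+ 2 :> R by ring.
    by rewrite (sqrtrM _ (sqr_ge0 3)) sqrtr_sqr ger0_norm.
  by rewrite ler_sqrt; lra.
have hD : `|Theta alpha eps f x| <= lil_threshold j + D.
  have -> : Theta alpha eps f x = A + ((Theta alpha (2 ^- k) f x - A) +
    (Theta alpha eps f x - Theta alpha (2 ^- k) f x)) by ring.
  apply: (le_trans (ler_normD _ _)); apply: lerD => //.
  apply: (le_trans (ler_normD _ _)); rewrite distrC in hA.
  apply: (le_trans (lerD hA hT)).
  rewrite (_ : _ + _ = C * (approximation_constant alpha + 2)); last by ring.
  apply: ler_wpM2l; first exact: ltW.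
  rewrite /increment_constant; have := approximation_constant_ge0 alpha_gt0 alpha_lt1; lra.
apply: (le_trans hD).
have : D * 1 <= D * Num.sqrt w by apply: ler_wpM2l => //; exact: ltW.
rewrite mulr1; lra.
Qed.

(** Borel-Cantelli: almost every x of [a, a + 1[ lies in finitely many
    exceedance sets only. *)
Lemma ae_limsup_Theta :
  {ae mu, forall x : R,
     (limf_esup (fun eps : R =>
        (`|Theta alpha eps f x| /
           Num.sqrt (ln (1 / eps) * ln (ln (ln (1 / eps)))))%:E) (at_right (0 : R))
      <= (13 * D)%:E)%E}.
Proof.
apply: negligible_of_unit_intervals => a.
have hN : mu.-negligible (lim_sup_set (fun j => lil_exceedance a (j + 4))).
  apply/negligibleP; last exact: lil_exceedance_limsup0.
  apply: bigcap_measurable => // n _; apply: bigcup_measurable => j _.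
  exact: measurable_exceedance.
apply: negligibleS hN => x [/= ax bad].
apply: contrapT => notin; apply: bad.
have [n hn] : exists n, forall j, (n <= j)%N -> ~ lil_exceedance a (j + 4) x.
  apply: contrapT => /forallNP h; apply: notin => n _.
  have /existsNP[j /not_implyP[nj /contrapT ej]] := h n.
  by exists j.
pose J := maxn 8 (n + 4).
have hJ j : (J <= j)%N -> ~ lil_exceedance a j x.
  rewrite geq_max => /andP[_ nj]; have j4 := leq_trans (leq_addl n 4) nj.
  by rewrite -(subnK j4); apply: hn; rewrite leq_subRL// addnC.
apply: (@limf_esup_at_right_le _ _ _ (2 ^- (2 ^ J))).
  by rewrite invr_gt0 exprn_gt0.
move=> e e0 eJ.
have h := Theta_iterated_log_off_exceedance ax (leq_maxl _ _) hJ e0 eJ.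
set s := Num.sqrt _ in h *.
have : 0 <= s by exact: sqrtr_ge0.
rewrite le_eqVlt => /predU1P[<-|s0].
  by rewrite invr0 mulr0 mulr_ge0// ltW.
by rewrite ler_pdivrMr.
Qed.

End iterated_logarithm.

Lemma Theta_constant (R : realType) (alpha eps : R) (f : R -> R) (x : R) :
  (forall y z, f y = f z) -> Theta alpha eps f x = 0.
Proof.
move=> cf; rewrite /Theta; under eq_Rintegral => h _.
  rewrite (cf (x + h) (x - h)) subrr !mul0r; over.
by rewrite Rintegral_cst ?mul0r//; exact: measurable_itv.
Qed.

Theorem theorem1 (R : realType) (alpha : R) (alpha_gt0 : 0 < alpha)
    (alpha_lt1 : alpha < 1) :
  exists c : R, 0 < c /\
    forall f : R -> R, holder_class alpha f ->
      (forall (I : set R) (eps : R),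
         is_interval I -> lebesgue_measure I = 1%E ->
         0 < eps -> eps < 1 / 2 ->
         (\int[@lebesgue_measure R]_(x in I) (`|Theta alpha eps f x| ^+ 2)%:E
            <= (c * ln (1 / eps) * holder_norm alpha f ^+ 2)%:E)%E)
      /\
      {ae @lebesgue_measure R, forall x : R,
         (limf_esup
            (fun eps : R =>
               (`|Theta alpha eps f x|
                  / Num.sqrt (ln (1 / eps) * ln (ln (ln (1 / eps)))))%:E)
            (at_right (0 : R))
          <= (c * holder_norm alpha f)%:E)%E}.
Proof.
set K := increment_constant alpha.
have K0 : 0 < K by exact: increment_constant_gt0.
exists (36 * K ^+ 2 + 13 * K); split.
  by rewrite addr_gt0// mulr_gt0// exprn_gt0.
move=> f hf; set A := holder_norm alpha f.
have A0 : 0 <= A by exact: holder_norm_ge0.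
have hA := holder_normP hf.
split=> [I eps Ii I1 e0 e12|].
  have e1 : eps <= 1 by clear I1; lra.
  under eq_integral do rewrite real_normK ?num_real//.
  apply: (le_trans (interval_length1_integral_le Ii I1
    (measurable_Theta alpha_gt0 A0 hA e0 e1)
    (fun a => integral_Theta_unit alpha_gt0 alpha_lt1 A0 hA a e0 e12))).
  rewrite lee_fin -/K.
  have l0 : 0 <= ln (1 / eps).
    by rewrite ln_ge0// ler_pdivlMr// mul1r.
  have -> : 3 * (12 * (A * K) ^+ 2 * ln (1 / eps)) =
    36 * K ^+ 2 * ln (1 / eps) * A ^+ 2 by ring.
  apply: ler_wpM2r; first exact: sqr_ge0.
  apply: ler_wpM2r => //.
  by rewrite lerDl mulr_ge0// ltW.
(* for vanishing seminorm f is constant; the exponential parameter of the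
   maximal inequality would then be infinite *)
have [A00|/negP/negP An0] := boolP (A == 0).
  have cf y z : f y = f z.
    apply/eqP; rewrite -subr_eq0 -normr_le0.
    by have := hA y z; rewrite -/A (eqP A00) mul0r.
  apply: aeW => x; apply: (@limf_esup_at_right_le _ _ _ 1) => // e _ _.
  by rewrite Theta_constant// normr0 mul0r (eqP A00) mulr0.
have Ap : 0 < A by rewrite lt_def An0.
have := ae_limsup_Theta alpha_gt0 alpha_lt1 Ap hA.
apply: negligibleS => x; apply: contra_not => /le_trans; apply.
rewrite lee_fin -/K.
have : 0 <= 36 * K ^+ 2 * A by rewrite mulr_ge0// mulr_ge0// sqr_ge0.
lra.
Qed.
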